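(* Let $C\subset\mathbb{R}^n$ be a closed cone, let $K\subset C$ be nonempty, closed, unbounded and convex, let $U\subset\mathbb{R}^n$ be an open set containing $K$, and let $f:C\cup U\to\mathbb{R}$ be continuous on $C$, weakly homogeneous of degree $\alpha>1$ relative to $K$, differentiable on $U$, convex on $K$, and bounded from below on $K$. For $u\in\mathbb{R}^n$ put $f_u(x):=f(x)+\langle u,x\rangle$, let $\mathcal{S}:\mathbb{R}^n\rightrightarrows\mathbb{R}^n$ be the solution map $\mathcal{S}(u)=\operatorname{Sol}(K,f_u)$, and let $\mathcal{D}(K,f):=(K^{\infty})^*-\nabla f(K)$. Then $\mathcal{S}$ is upper semicontinuous on $\operatorname{int}(\mathcal{D}(K,f))$.
   Context: A cone is a nonempty set closed under multiplication by positive scalars. For a nonempty closed set $S\subset\mathbb{R}^n$, the asymptotic cone is $S^{\infty}=\{v\in\mathbb{R}^n:\exists t_k\to+\infty,\ \exists x^k\in S,\ \lim_{k\to\infty} x^k/t_k=v\}$. The dual cone of a cone $D$ is $D^*=\{u\in\mathbb{R}^n:\langle u,v\rangle\ge 0\ \forall v\in D\}$; $\operatorname{int}$ denotes topological interior. $\nabla f(K)=\{\nabla f(x):x\in K\}$, and $A-B=\{a-b:a\in A,\ b\in B\}$ for sets $A,B\subset\mathbb{R}^n$. $f$ is weakly homogeneous of degree $\alpha>0$ relative to $K$ if there is a continuous function $h:C\to\mathbb{R}$, positively homogeneous of degree $\alpha$ (that is, $h(tx)=t^{\alpha}h(x)$ for all $x\in C$, $t>0$), such that $f(x)-h(x)=o(\|x\|^{\alpha})$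 on $K$ (i.e. $(f(x)-h(x))/\|x\|^{\alpha}\to 0$ as $\|x\|\to\infty$ with $x\in K$). For a nonempty closed set $S$ and a continuous function $g$ on $S$, $\operatorname{Sol}(S,g)$ is the (possibly empty) set of global minimizers of $g$ over $S$. A set-valued map $\Phi:\mathbb{R}^m\rightrightarrows\mathbb{R}^n$ is upper semicontinuous at $x$ if for every open $V\subset\mathbb{R}^n$ with $\Phi(x)\subset V$ there is a neighborhood $W$ of $x$ such that $\Phi(x')\subset V$ for all $x'\in W$; it is upper semicontinuous on $T\subset\mathbb{R}^m$ if it is so at every $x\in T$. *)

(* Defs.v *)
From HB Require Import structures.
From mathcomp Require Import all_boot all_order all_algebra.
From mathcomp Require Import all_classical all_reals all_analysis.

Set Implicit Arguments.
Unset Strict Implicit.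
Unset Printing Implicit Defensive.

Import Order.TTheory GRing.Theory Num.Theory.
Import numFieldNormedType.Exports.

Local Open Scope classical_set_scope.
Local Open Scope ring_scope.

(* R^n is the type 'rV[R]_n of row vectors. Its library topology is the usual
   one, but its library norm is the max norm, hence the Euclidean norm below. *)

Definition dotp (R : realType) (n : nat) (x y : 'rV[R]_n) : R :=
  \sum_(i < n) x 0 i * y 0 i.

Definition enorm (R : realType) (n : nat) (x : 'rV[R]_n) : R :=
  Num.sqrt (dotp x x).

Definition is_cone (R : realType) (n : nat) (D : set 'rV[R]_n) : Prop :=
  D !=set0 /\ forall (t : R) x, 0 < t -> D x -> D (t *: x).

Definition asymptotic_cone (R : realType) (n : nat) (S : set 'rV[R]_n) :
    set 'rV[R]_n :=
  [set v | exists (t : nat -> R) (x : nat -> 'rV[R]_n),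
     [/\ t k @[k --> \oo] --> +oo,
         forall k, S (x k) &
         (t k)^-1 *: x k @[k --> \oo] --> v]].

Definition dual_cone (R : realType) (n : nat) (D : set 'rV[R]_n) :
    set 'rV[R]_n :=
  [set u | forall v, D v -> 0 <= dotp u v].

Definition grad (R : realType) (n : nat) (f : 'rV[R]_n -> R) (x : 'rV[R]_n) :
    'rV[R]_n :=
  \row_(i < n) 'D_(delta_mx 0 i) f x.

Definition set_sub (R : realType) (n : nat) (A B : set 'rV[R]_n) :
    set 'rV[R]_n :=
  [set a - b | a in A & b in B].

(* Functions with domain a subset of R^n are represented by total functions;
   every condition below only involves their values on the relevant subset. *)

Definition pos_homogeneous (R : realType) (n : nat) (C : set 'rV[R]_n)
    (alpha : R) (h : 'rV[R]_n -> R) : Prop :=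
  forall (x : 'rV[R]_n) (t : R), C x -> 0 < t -> h (t *: x) = t `^ alpha * h x.

(* [g x = o(||x|| ^ alpha)] as [||x||] tends to infinity with [x] in [K]. *)
Definition littleo_infty_on (R : realType) (n : nat) (K : set 'rV[R]_n)
    (alpha : R) (g : 'rV[R]_n -> R) : Prop :=
  forall eps : R, 0 < eps ->
    exists M : R, forall x : 'rV[R]_n, K x -> M < enorm x ->
      `| g x / enorm x `^ alpha | < eps.

Definition weakly_homogeneous (R : realType) (n : nat) (C K : set 'rV[R]_n)
    (alpha : R) (f : 'rV[R]_n -> R) : Prop :=
  0 < alpha /\
  exists h : 'rV[R]_n -> R,
    [/\ {within C, continuous h},
        pos_homogeneous C alpha h &
        littleo_infty_on K alpha (fun x => f x - h x)].

Definition Sol (R : realType) (n : nat) (S : set 'rV[R]_n)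
    (g : 'rV[R]_n -> R) : set 'rV[R]_n :=
  [set x | S x /\ forall y, S y -> g x <= g y].

Definition perturb (R : realType) (n : nat) (f : 'rV[R]_n -> R)
    (u : 'rV[R]_n) : 'rV[R]_n -> R :=
  fun x => f x + dotp u x.

Definition solution_map (R : realType) (n : nat) (K : set 'rV[R]_n)
    (f : 'rV[R]_n -> R) (u : 'rV[R]_n) : set 'rV[R]_n :=
  Sol K (perturb f u).

Definition Dset (R : realType) (n : nat) (K : set 'rV[R]_n)
    (f : 'rV[R]_n -> R) : set 'rV[R]_n :=
  set_sub (dual_cone (asymptotic_cone K)) (grad f @` K).

Definition usc_at (X Y : topologicalType) (Phi : X -> set Y) (x : X) : Prop :=
  forall V : set Y, open V -> Phi x `<=` V ->
    \forall x' \near x, Phi x' `<=` V.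

Definition usc_on (X Y : topologicalType) (Phi : X -> set Y) (T : set X) :
    Prop :=
  forall x, T x -> usc_at Phi x.

(* Main.v *)
(* Solutions stay bounded near an interior point u0 of D(K, f): otherwise there
   are u_k -> u0 and solutions x_k with |x_k| -> oo and x_k / |x_k| -> w, a
   nonzero asymptotic direction of K.  For small d > 0, u0 - d w still lies in
   D(K, f), say u0 - d w = a - grad f(y).  The gradient inequality at y together
   with the optimality of x_k against y gives <grad f(y) + u_k, x_k - y> <= 0,
   hence <a + d w, w> <= 0 in the limit, whereas <a, w> >= 0 and w != 0.
   Compactness and the closed graph of the solution map then give upper
   semicontinuity. *)
Require Import Defs.
From HB Require Import structures.
From mathcomp Require Import all_boot all_order all_algebra.
From mathcomp Require Import all_classical all_reals all_analysis.
From mathcomp Require Import ring lra.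

Set Implicit Arguments.
Unset Strict Implicit.
Unset Printing Implicit Defensive.

Import Order.TTheory GRing.Theory Num.Theory.
Import numFieldNormedType.Exports.

Local Open Scope classical_set_scope.
Local Open Scope ring_scope.

Lemma dotpDl (R : realType) (n : nat) (x y z : 'rV[R]_n) :
  dotp (x + y) z = dotp x z + dotp y z.
Proof.
by rewrite /dotp -big_split; apply: eq_bigr => i _; rewrite mxE mulrDl.
Qed.

Lemma dotpC (R : realType) (n : nat) (x y : 'rV[R]_n) : dotp x y = dotp y x.
Proof. by apply: eq_bigr => i _; rewrite mulrC. Qed.

Lemma dotpZl (R : realType) (n : nat) (a : R) (x y : 'rV[R]_n) :
  dotp (a *: x) y = a * dotp x y.
Proof.
by rewrite /dotp mulr_sumr; apply: eq_bigr => i _; rewrite mxE mulrA.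
Qed.

Lemma dotpBr (R : realType) (n : nat) (x y z : 'rV[R]_n) :
  dotp x (y - z) = dotp x y - dotp x z.
Proof. by rewrite dotpC dotpDl -scaleN1r dotpZl mulN1r !(dotpC x). Qed.

Lemma dotpZr (R : realType) (n : nat) (a : R) (x y : 'rV[R]_n) :
  dotp x (a *: y) = a * dotp x y.
Proof. by rewrite dotpC dotpZl dotpC. Qed.

Lemma dotpxx_gt0 (R : realType) (n : nat) (x : 'rV[R]_n) :
  x != 0 -> 0 < dotp x x.
Proof.
move=> x0; have sq i : true -> 0 <= x 0 i * x 0 i by rewrite -expr2 sqr_ge0.
rewrite lt_def sumr_ge0 // andbT; apply: contra_neq x0 => /(psumr_eq0P sq) x0.
by apply/rowP => i; apply/eqP; have /eqP := x0 i isT; rewrite mxE mulf_eq0 orbb.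
Qed.

Lemma cvg_dotp (R : realType) (n : nat) (T : Type) (F : set_system T)
    {FF : Filter F} (x y : T -> 'rV[R]_n) (a b : 'rV[R]_n) :
  x @ F --> a -> y @ F --> b -> dotp (x k) (y k) @[k --> F] --> dotp a b.
Proof.
move=> xa yb; rewrite /dotp.
have coord i (z : T -> 'rV[R]_n) (c : 'rV[R]_n) :
    z @ F --> c -> z k 0 i @[k --> F] --> c 0 i.
  by move=> zc; exact: (cvg_comp _ _ zc (@coord_continuous R 1 n 0 i c)).
by apply: cvg_big => [|i _]; [exact: add_continuous|apply: cvgM; exact: coord].
Qed.

Lemma cvg_dist_lt_harmonic (R : realType) (V : normedModType R) (u : nat -> V)
    (l : V) :
  (forall k, `|l - u k| < k.+1%:R^-1) -> u k @[k --> \oo] --> l.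
Proof.
move=> ul; apply/cvgrPdist_lt => e e0.
have /cvgrPdist_lt /(_ e e0) := @cvg_harmonic R.
apply: filterS => k; rewrite /harmonic/= sub0r normrN ger0_norm //.
exact: lt_trans.
Qed.

(** Each failure supplies a bad point at distance less than [1 / (k + 1)] from [u0]. The predicate
    may depend on [k], so that a bound to be violated can grow along the sequence. *)
Lemma not_near_seq (R : realType) (V : normedModType R) (u0 : V)
    (P : nat -> set V) :
  (forall k, ~ \forall u \near u0, P k u) ->
  exists2 u : nat -> V, u k @[k --> \oo] --> u0 & forall k, ~ P k (u k).
Proof.
move=> nP.
have /choice[u Pu] k : exists u, `|u0 - u| < k.+1%:R^-1 /\ ~ P k u.
  apply: contrapT => /forallNP H; apply: (nP k).
  apply/nbhs_normP; exists k.+1%:R^-1 => /=; first by rewrite invr_gt0 ltr0Sn.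
  by move=> u ulk; apply: contrapT => nPu; apply: (H u).
exists u => [|k]; last by case: (Pu k).
by apply: cvg_dist_lt_harmonic => k; case: (Pu k).
Qed.

Lemma cvg_le_id (s : nat -> nat) :
  (forall k, (k <= s k)%N) -> s k @[k --> \oo] --> \oo.
Proof.
move=> ks A [N _ NA]; exists N => // k /= Nk; apply: NA => /=.
exact: leq_trans Nk (ks k).
Qed.

(** A closed ball is compact, so the sequence clusters at some [l]; [s k] is an index beyond [k]
    whose term is within [1 / (k + 1)] of [l]. The map [s] need not be increasing: [k <= s k]
    already carries limits over to the extraction. *)
Lemma bounded_seq_cvg_extraction (R : realType) (n : nat)
    (x : nat -> 'rV[R]_n) (M : R) :
  (forall k, `|x k| <= M) ->
  exists (s : nat -> nat) (l : 'rV[R]_n),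
    (forall k, (k <= s k)%N) /\ x (s k) @[k --> \oo] --> l.
Proof.
move=> xM; pose A := [set y : 'rV[R]_n | `|y| <= M].
have cA : compact A.
  apply: bounded_closed_compact.
    exists M; split; first exact: num_real.
    by move=> r Mr y /= /le_trans; apply; exact: ltW.
  have -> : A = Num.norm @^-1` [set r | r <= M] by [].
  move/continuous_closedP: (@norm_continuous R 'rV[R]_n); apply.
  exact: closed_le.
have [|l [_ cl]] := cA (x k @[k --> \oo]) _.
  by exists 0%N => // k _; exact: xM.
have /choice[s Ps] k : exists j, (k <= j)%N /\ `|l - x j| < k.+1%:R^-1.
  have [||y [[j kj <-] lj]] :=
    cl [set x j | j in [set j | (k <= j)%N]] (ball l k.+1%:R^-1).
  - by exists k => // j /= kj; exists j.
  - by apply: nbhsx_ballx; rewrite invr_gt0 ltr0Sn.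
  - by exists j; split=> //; rewrite -ball_normE in lj.
exists s, l; split=> [k|]; first by case: (Ps k).
by apply: cvg_dist_lt_harmonic => k; case: (Ps k).
Qed.

Lemma diff_dotp_grad (R : realType) (n : nat) (f : 'rV[R]_n -> R)
    (y v : 'rV[R]_n) :
  differentiable f y -> 'd f y v = dotp (grad f y) v.
Proof.
move=> df; rewrite {1}(row_sum_delta v) linear_sum; apply: eq_bigr => i _.
by rewrite linearZ mxE deriveE // mulrC.
Qed.

(** The derivative at [y] along [x - y] is a limit of difference quotients, and convexity bounds
    each of them by [f x - f y] for steps [t] in [(0, 1]]. *)
Lemma convex_gradient_le (R : realType) (n : nat) (K : set 'rV[R]_n)
    (f : 'rV[R]_n -> R) (x y : 'rV[R]_n) :
  convex_function K f -> K x -> K y -> differentiable f y ->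
  f y + dotp (grad f y) (x - y) <= f x.
Proof.
move=> cf Kx Ky df; rewrite -diff_dotp_grad // -deriveE // -lerBrDl.
have dv : derivable f y (x - y) by exact: diff_derivable.
(* Only steps [t > 0] stay on the segment from [y] to [x], so the two-sided limit is replaced by the
   right-hand one. *)
rewrite ['D_(x - y) f y]cvg_at_rightE //; apply: limr_le.
  apply: cvgP; apply: cvg_trans dv; apply: cvg_app => A [e e0 Ae].
  by exists e => // t te t0; apply: Ae => //; exact: lt0r_neq0.
near=> t.
have t0 : 0 < t by near: t; exact: nbhs_right_gt.
have t1 : t <= 1 by near: t; exact: nbhs_right_le.
have := cf (Itv01 (ltW t0) t1) x y (mem_set Kx) (mem_set Ky).
rewrite convRE /= => cft.
rewrite -[_ *: _]/(_ * _) mulrC ler_pdivrMr //.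
have -> : t *: (x - y) + y = t *: x + (1 - t) *: y.
  by rewrite scalerBr scalerBl scale1r addrAC addrA.
have -> : (f x - f y) * t = t * f x + (1 - t) * f y - f y by ring.
by rewrite lerD2r.
Unshelve. all: by end_near.
Qed.

(** For each fixed competitor [y], the optimality inequality of [x k] passes to the limit on both
    sides. *)
Lemma solution_map_closed (R : realType) (n : nat) (K : set 'rV[R]_n)
    (f : 'rV[R]_n -> R) (u x : nat -> 'rV[R]_n) (u0 x0 : 'rV[R]_n) :
  closed K -> (forall y, K y -> {for y, continuous f}) ->
  u k @[k --> \oo] --> u0 -> x k @[k --> \oo] --> x0 ->
  (forall k, solution_map K f (u k) (x k)) -> solution_map K f u0 x0.
Proof.
move=> Kcl fc uu0 xx0 Sx.
have Kx0 : K x0.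
  by apply: (closed_cvg K Kcl _ _ xx0); apply: nearW => k; case: (Sx k).
split=> // y Ky; rewrite /perturb.
have fx : f (x k) @[k --> \oo] --> f x0 by exact: (cvg_comp _ _ xx0 (fc _ Kx0)).
have l : f (x k) + dotp (u k) (x k) @[k --> \oo] --> f x0 + dotp u0 x0.
  by apply: cvgD => //; exact: cvg_dotp.
have r : f y + dotp (u k) y @[k --> \oo] --> f y + dotp u0 y.
  by apply: cvgD; [exact: cvg_cst|apply: cvg_dotp => //; exact: cvg_cst].
by apply: (ler_cvg_to l r); apply: nearW => k; case: (Sx k) => _; apply.
Qed.

Lemma solution_map_locally_bounded (R : realType) (n : nat)
    (K : set 'rV[R]_n) (f : 'rV[R]_n -> R) (u0 : 'rV[R]_n) :
  convex_function K f -> (forall y, K y -> differentiable f y) ->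
  interior (Dset K f) u0 ->
  exists M : R, \forall u \near u0, forall x, solution_map K f u x -> `|x| <= M.
Proof.
move=> cf df iD; apply: contrapT => /forallNP nb.
(* The bound [k + 1] fails arbitrarily close to [u0]; this yields the unbounded solutions, and their
   norms are positive from [k = 0] on. *)
have [u uu0 nu] := not_near_seq (fun k => nb k.+1%:R).
have /choice[x Px] k : exists x, solution_map K f (u k) x /\ k.+1%:R < `|x|.
  have /existsNP[x /not_implyP[Sx /negP]] := nu k.
  by rewrite -ltNge => xk; exists x.
have x0 k : 0 < `|x k| by exact: lt_trans (Px k).2.
pose v k := `|x k|^-1 *: x k.
have nv k : `|v k| = 1.
  by rewrite normrZ ger0_norm ?invr_ge0 // mulVf // gt_eqF.
have [|s [w [ks vw]]] := @bounded_seq_cvg_extraction _ _ v 1.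
  by move=> k; rewrite nv.
have us : u (s k) @[k --> \oo] --> u0.
  exact: (cvg_comp _ _ (cvg_le_id ks) uu0).
have xoo : `|x (s k)| @[k --> \oo] --> +oo.
  apply/cvgryPge => A; near=> k; apply: le_trans (ltW (Px (s k)).2).
  apply: (@le_trans _ _ k%:R); last by rewrite ler_nat (leq_trans (ks k)).
  by near: k; exact: nbhs_infty_ger.
have w1 : `|w| = 1.
  apply: (cvg_unique _ (cvg_norm vw)) => //.
  by rewrite (_ : (fun k => _) = cst 1); [exact: cvg_cst|apply/funext => k /=].
have w0 : w != 0 by rewrite -normr_gt0 w1.
have Kw : asymptotic_cone K w.
  exists (fun k => `|x (s k)|), (x \o s); split=> // k.
  by case: (Px (s k)) => -[].
have [d d0 [a aK [_ [y Ky <-] ay]]] :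
    exists2 d : R, 0 < d & Dset K f (u0 - d *: w).
  (* Since [w] has norm 1, the shift [d *: w] has norm [e / 2], which stays inside the ball of
     radius [e] around [u0]. *)
  move/nbhs_normP: iD => [e /= e0 eD]; exists (e / 2).
    by rewrite divr_gt0.
  apply: eD => /=; rewrite opprB addrC subrK normrZ w1 mulr1.
  rewrite gtr0_norm ?divr_gt0 //.
  by rewrite ltr_pdivrMr // ltr_pMr // ltr1n.
(* Dividing by the norm of [x (s k)] makes the contribution of the fixed point [y] vanish in the
   limit. *)
have dxy k : dotp (grad f y + u (s k)) (v (s k) - `|x (s k)|^-1 *: y) <= 0.
  rewrite -scalerBr dotpZr pmulr_rle0 ?invr_gt0 //.
  have [[Kx /(_ y Ky) xy] _] := Px (s k).
  have := convex_gradient_le cf Kx Ky (df _ Ky).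
  move: xy; rewrite /perturb dotpDl (dotpBr (u _)); lra.
have : dotp (grad f y + u0) w <= 0.
  have xV : `|x (s k)|^-1 @[k --> \oo] --> 0.
    by apply/gtr0_cvgV0 => //; exact: nearW (fun k => x0 (s k)).
  have vy : v (s k) - `|x (s k)|^-1 *: y @[k --> \oo] --> w - 0 *: y.
    by apply: cvgB => //; exact: cvgZr_tmp.
  have gu : grad f y + u (s k) @[k --> \oo] --> grad f y + u0.
    by apply: cvgD => //; exact: cvg_cst.
  have /(_ _) l := cvg_dotp gu vy; rewrite scale0r subr0 in l.
  by apply: (ler_cvg_to l (cvg_cst 0)); exact: nearW.
have -> : grad f y + u0 = a + d *: w.
  by rewrite -[u0](subrK (d *: w)) -ay addrA addrCA subrr addr0.
apply/negP; rewrite -ltNge dotpDl dotpZl ltr_wpDl ?aK // mulr_gt0 //.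
exact: dotpxx_gt0.
Unshelve. all: by end_near.
Qed.

Theorem theorem6p2 (R : realType) (n : nat) (C K U : set 'rV[R]_n)
    (f : 'rV[R]_n -> R) (alpha : R)
    (C_cone : is_cone C) (C_closed : closed C)
    (KC : K `<=` C) (K_nonempty : K !=set0) (K_closed : closed K)
    (K_unbounded : ~ bounded_set K) (K_convex : convex_set K)
    (U_open : open U) (KU : K `<=` U)
    (f_cont : {within C, continuous f})
    (alpha_gt1 : 1 < alpha)
    (f_whom : weakly_homogeneous C K alpha f)
    (f_diff : forall x, U x -> differentiable f x)
    (f_convex : convex_function K f)
    (f_bounded_below : exists m : R, forall x, K x -> m <= f x) :
  usc_on (solution_map K f) (interior (Dset K f)).
Proof.
have df y : K y -> differentiable f y by move=> /KU; exact: f_diff.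
move=> u0 /(solution_map_locally_bounded f_convex df)[M nM] V oV SV.
apply: contrapT => nV.
(* Negating this implication gives parameters that keep the bound [M] and still have a solution
   outside [V]; were it true near [u0], [nM] would contradict [nV]. *)
have [|u uu0 nu] := @not_near_seq _ _ u0 (fun _ u =>
    (forall x, solution_map K f u x -> `|x| <= M) ->
    solution_map K f u `<=` V).
  by move=> _ H; apply: nV; apply: filterS2 nM H => u ?; apply.
have /choice[x Px] k :
    exists x, [/\ solution_map K f (u k) x, `|x| <= M & ~ V x].
  have /not_implyP[uM /existsNP[x /not_implyP[Sx nVx]]] := nu k.
  by exists x; split => //; exact: uM.
have [|s [l [ks xl]]] := @bounded_seq_cvg_extraction _ _ x M.
  by move=> k; case: (Px k).
(* The limit stays in the closed complement of [V], whereas the closed graph makes it a solution for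
   [u0], hence a point of [V]. *)
have : (~` V) l.
  apply: (closed_cvg _ (open_closedC oV) _ _ xl).
  by apply: nearW => k; case: (Px (s k)).
apply; apply: SV; apply: solution_map_closed K_closed _ _ xl _.
- by move=> y /df; exact: differentiable_continuous.
- exact: (cvg_comp _ _ (cvg_le_id ks) uu0).
- by move=> k; case: (Px (s k)).
Qed.
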